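(* Let $X$ and $Y$ be finite nonempty subsets of $\mathbb{R}^d$ with radius functions $\mathbf{r}:X\to\mathcal{C}^1_+$ and $\mathbf{s}:Y\to\mathcal{C}^1_+$. Let $\eta\subseteq X\times Y$ be a relation such that for every $x\in X$ there is a $y\in Y$ with $(x,y)\in\eta$ and for every $y\in Y$ there is an $x\in X$ with $(x,y)\in\eta$. Let $K$ be a compact subset of $\mathbb{R}^d$ that contains $X\cup Y$. Then $$\|f_{X,\mathbf{r}}-f_{Y,\mathbf{s}}\|_K\le D(\mathbf{r},\mathbf{s})_{\eta,K}+\|\eta\|\max\bigl(S(\mathbf{r})_K,\,S(\mathbf{s})_K\bigr).$$
   Context: $\mathbb{R}^d$ carries the Euclidean distance $d(x,y)=\|x-y\|$. $\mathcal{C}^1_+$ denotes the set of continuously differentiable bijections $\phi:[0,\infty)\to[0,\infty)$ with positive first derivative on $[0,\infty)$ (one-sided at $0$). A radius function on $X$ is a function $\mathbf{r}:X\to\mathcal{C}^1_+$; write $\mathbf{r}_x=\mathbf{r}(x)$, and $\mathbf{r}_x^{-1}$ for the inverse function of $\mathbf{r}_x$. The entry function $f_{X,\mathbf{r}}:\mathbb{R}^d\to[0,\infty)$ is $f_{X,\mathbf{r}}(y)=\min_{x\in X}\mathbf{r}_x^{-1}(d(y,x))$; $f_{Y,\mathbf{s}}$ is defined likewise. For compact $L$ and continuous $h:L\to\mathbb{R}$, $\|h\|_L=\max_{x\in L}|h(x)|$ (functions defined on larger sets are restricted to $L$). Further, $$\|\eta\|=\max_{(x,y)\in\eta}d(x,y),\qquad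 D(\mathbf{r},\mathbf{s})_{\eta,K}=\max_{(x,y)\in\eta}\|\mathbf{r}_x^{-1}-\mathbf{s}_y^{-1}\|_{[0,\operatorname{diam}(K)]},\qquad S(\mathbf{r})_K=\max_{x\in X}\|(\mathbf{r}_x^{-1})'\|_{[0,\operatorname{diam}(K)]},$$ and $S(\mathbf{s})_K=\max_{y\in Y}\|(\mathbf{s}_y^{-1})'\|_{[0,\operatorname{diam}(K)]}$. *)

(* Defs.v *)
From HB Require Import structures.
From mathcomp Require Import all_boot all_order all_algebra.
From mathcomp Require Import all_classical all_reals all_analysis.

Set Implicit Arguments.
Unset Strict Implicit.
Unset Printing Implicit Defensive.

Import Order.TTheory GRing.Theory Num.Theory.
Import numFieldTopology.Exports numFieldNormedType.Exports.
Local Open Scope classical_set_scope.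
Local Open Scope ring_scope.

(* The norm of the library on row vectors is the sup norm, hence an explicit
   Euclidean distance; both norms induce the topology of ['rV[R]_d], so
   [compact] has its usual meaning. *)
Definition edist (R : realType) (d : nat) (x y : 'rV[R]_d) : R :=
  Num.sqrt (\sum_(i < d) (x 0 i - y 0 i) ^+ 2).

Definition diam (R : realType) (d : nat) (K : set 'rV[R]_d) : R :=
  sup [set edist p.1 p.2 | p in K `*` K].

(* All minima and maxima are rendered by [inf] and [sup], taken over finite
   nonempty sets or over continuous images of nonempty compact sets.
   The next two lemmas say that they are then attained. *)
Lemma compact_sup_in (R : realType) (A : set R) :
  compact A -> A !=set0 -> A (sup A).
Proof.
move=> cA A0; have cid : {within A, continuous (@id R)}.
  by apply: continuous_subspaceT => x; exact: cvg_id.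
have [c cinA cmax] := compact_EVT_max A0 cA cid.
move: (cinA); rewrite inE => Ac.
suff -> : sup A = c by [].
have ubc : ubound A c by move=> x Ax; apply: cmax; rewrite inE.
apply/eqP; rewrite eq_le; apply/andP; split; first exact: ge_sup.
by apply: ub_le_sup => //; exists c.
Qed.

Lemma compact_inf_in (R : realType) (A : set R) :
  compact A -> A !=set0 -> A (inf A).
Proof.
move=> cA A0; have cid : {within A, continuous (@id R)}.
  by apply: continuous_subspaceT => x; exact: cvg_id.
have [c cinA cmin] := compact_EVT_min A0 cA cid.
move: (cinA); rewrite inE => Ac.
suff -> : inf A = c by [].
have lbc : lbound A c by move=> x Ax; apply: cmin; rewrite inE.
apply/eqP; rewrite eq_le; apply/andP; split; last exact: lb_le_inf.
by apply: ge_inf => //; exists c.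
Qed.

Definition maxnorm (R : realType) (T : Type) (L : set T) (h : T -> R) : R :=
  sup [set `|h x| | x in L].

(* Functions on [0, oo) are represented by functions on R whose values at
   negative arguments are irrelevant: difference quotients only use arguments
   in [0, oo), so that the derivative is one-sided at 0 and the ordinary one at
   every t > 0. *)
Definition diffquot (R : realType) (f : R -> R) (t u : R) : R :=
  (f u - f t) / (u - t).

Definition nnderivable (R : realType) (f : R -> R) (t : R) : Prop :=
  cvg (diffquot f t u @[u --> within `[0, +oo[ t^']).

Definition nnderiv (R : realType) (f : R -> R) (t : R) : R :=
  lim (diffquot f t u @[u --> within `[0, +oo[ t^']).

Definition C1plus (R : realType) : set (R -> R) :=
  [set phi | [/\ set_bij `[0, +oo[ `[0, +oo[ phi,
    forall t : R, 0 <= t -> nnderivable phi t,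
    {within `[0, +oo[, continuous (nnderiv phi)} &
    forall t : R, 0 <= t -> 0 < nnderiv phi t]].

(* inverse of a bijection of [0, oo); its values are irrelevant elsewhere *)
Definition nninv (R : realType) (phi : R -> R) : R -> R :=
  'pinv_(fun=> 0) `[0, +oo[ phi.

Definition radius_function (R : realType) (d : nat) (X : set 'rV[R]_d)
    (r : 'rV[R]_d -> R -> R) : Prop :=
  forall x, X x -> @C1plus R (r x).

Definition entry (R : realType) (d : nat) (X : set 'rV[R]_d)
    (r : 'rV[R]_d -> R -> R) (y : 'rV[R]_d) : R :=
  inf [set nninv (r x) (edist y x) | x in X].

Definition correspondence (R : realType) (d : nat) (X Y : set 'rV[R]_d)
    (eta : set ('rV[R]_d * 'rV[R]_d)) : Prop :=
  [/\ eta `<=` X `*` Y,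
    forall x, X x -> exists2 y, Y y & eta (x, y) &
    forall y, Y y -> exists2 x, X x & eta (x, y)].

Definition relnorm (R : realType) (d : nat)
    (eta : set ('rV[R]_d * 'rV[R]_d)) : R :=
  sup [set edist p.1 p.2 | p in eta].

Definition radius_dist (R : realType) (d : nat) (r s : 'rV[R]_d -> R -> R)
    (eta : set ('rV[R]_d * 'rV[R]_d)) (K : set 'rV[R]_d) : R :=
  sup [set maxnorm `[0, diam K]
         (fun t => nninv (r p.1) t - nninv (s p.2) t) | p in eta].

Definition max_slope (R : realType) (d : nat) (X : set 'rV[R]_d)
    (r : 'rV[R]_d -> R -> R) (K : set 'rV[R]_d) : R :=
  sup [set maxnorm `[0, diam K] (nnderiv (nninv (r x))) | x in X].

(* Main.v *)
Require Import Defs.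
From HB Require Import structures.
From mathcomp Require Import all_boot all_order all_algebra.
From mathcomp Require Import all_classical all_reals all_analysis.
From mathcomp Require Import ring lra.

(** The entry functions are minima of the entry times [nninv (r x) (edist p x)].
    A minimum changes by at most [c] when its terms can be matched, in both
    directions, with terms differing by at most [c] ([entry_le]), so it
    suffices to compare the entry times of two points matched by [eta].  With
    [f] and [g] the inverse radius functions of the matched points [x] and [y],
    and [a], [b] the distances from [p] to [x] and [y], write
      [f a - g b = (f a - g a) + (g a - g b)].
    The first difference is at most the distance of the radius functions,
    because [a] lies in [[0, diam K]]; the second is at most [|a - b|] times the
    slope bound of [g], by the mean value theorem, and [|a - b|] is at most
    [edist x y] by the triangle inequality.

    Two points need care.  The mean value theorem is applied to an inverse
    function, so the class of radius functions is shown to be closed under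
    inversion ([C1plus_nninv]), including the one-sided derivative at [0].
    Each supremum bounds the values it ranges over only if these are bounded
    above; this comes from compactness for [K] and for [[0, diam K]]
    ([le_maxnorm], [edist_le_diam]) and from finiteness for [X], [Y] and [eta]
    ([finite_le_sup]). *)

Set Implicit Arguments.
Unset Strict Implicit.
Unset Printing Implicit Defensive.

Import Order.TTheory GRing.Theory Num.Theory.
Import numFieldTopology.Exports numFieldNormedType.Exports.
Local Open Scope classical_set_scope.
Local Open Scope ring_scope.

(* [edist] is also the name of the extended distance of metric spaces. *)
Local Notation edist := Defs.edist.

(** * Suprema that bound their members *)

Lemma le_maxnorm (R : realType) (T : topologicalType) (L : set T) (h : T -> R)
    (x : T) : compact L -> {within L, continuous h} -> L x ->
  `|h x| <= maxnorm L h.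
Proof.
move=> cL hc Lx; apply: ub_le_sup; last by exists x.
have [M [_ hM]] := compact_bounded (continuous_compact hc cL).
exists (M + 1) => _ [y Ly <-]; apply: hM; first by rewrite ltrDl.
by exists y.
Qed.

Lemma finite_le_sup (R : realType) (T : Type) (A : set T) (F : T -> R) (i : T) :
  finite_set A -> A i -> F i <= sup [set F i | i in A].
Proof.
move=> finA Ai; apply: ub_le_sup; last by exists i.
have finFA : finite_set [set F i | i in A] by exact: finite_image.
by have [] := compact_has_sup (ex_intro _ _ (imageP F Ai)) (finite_compact finFA).
Qed.

(** * Inverses of radius functions *)

(** The limits of difference quotients that define [nnderiv] are unique only
    because [t] is a limit point of the half-line; approach it from the
    right. *)
Lemma nndnbhs_proper (R : realType) (t : R) :
  0 <= t -> ProperFilter (within `[0, +oo[ t^').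
Proof.
move=> t0; apply: Build_ProperFilter_ex => P.
rewrite /within/= => /(@nbhs_ballP R R^o)[e /= e0 eP].
exists (t + e / 2); apply: eP => /=.
- rewrite /ball/= opprD addNKr normrN gtr0_norm ?divr_gt0//.
  by rewrite ltr_pdivrMr// ltr_pMr// ltrDl.
- by rewrite -subr_eq0 addrC addKr gt_eqF// divr_gt0.
- by rewrite in_itv/= andbT addr_ge0// ltW// divr_gt0.
Qed.

Section C1plusTheory.
Variables (R : realType) (f : R -> R).
Hypothesis fC : C1plus f.

Lemma C1plus_ge0 (t : R) : 0 <= t -> 0 <= f t.
Proof.
have [[fun_f _ _] _ _ _] := fC.
by move=> t0; have := fun_f t; rewrite /= !in_itv/= !andbT; apply.
Qed.

Lemma C1plus_diffquot (t : R) : 0 <= t ->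
  diffquot f t u @[u --> within `[0, +oo[ t^'] --> nnderiv f t.
Proof. by have [_ + _ _] := fC; apply. Qed.

Lemma C1plus_cvg (t : R) : 0 <= t ->
  f u @[u --> within `[0, +oo[ (nbhs t)] --> f t.
Proof.
move=> t0.
have cf : f u @[u --> within `[0, +oo[ t^'] --> f t.
  have ftE : f t = f t + nnderiv f t * (t - t) by rewrite subrr mulr0 addr0.
  rewrite [X in _ --> X]ftE.
  have /cvg_trans : f u @[u --> within `[0, +oo[ t^'] `=>`
      (f t + diffquot f t u * (u - t)) @[u --> within `[0, +oo[ t^'].
    apply: near_eq_cvg; rewrite !near_withinE; apply: filterE => u ut _.
    by rewrite /diffquot divfK ?subr_eq0// addrC subrK.
  apply; apply: cvgD; first exact: cvg_cst.
  apply: cvgM; first exact: C1plus_diffquot.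
  apply: cvg_within_filter; apply: cvg_within_filter.
  by apply: cvgB; [exact: cvg_id|exact: cvg_cst].
apply/cvgrPdist_lt => e e0.
have /cvgrPdist_lt/(_ e e0) := cf.
rewrite !near_withinE; apply: filterS => u H Du.
have [->|ut] := eqVneq u t; first by rewrite subrr normr0.
by apply: H.
Qed.

Lemma C1plus_continuous : {within `[0, +oo[, continuous f}.
Proof.
apply/subspace_continuousP => t /=; rewrite in_itv/= andbT; exact: C1plus_cvg.
Qed.

(** Away from [0] the half-line is a neighbourhood of [t], so the restricted
    derivative is the ordinary one.  In Caratheodory's form the witness is the
    difference quotient completed by its limit. *)
Lemma C1plus_is_derive (t : R) : 0 < t -> is_derive t 1 f (nnderiv f t).
Proof.
move=> t0; apply/is_derive1_caratheodory.
exists (fun u => if u == t then nnderiv f t else diffquot f t u); split.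
- move=> z; case: eqVneq => [->|zt]; first by rewrite !subrr mulr0.
  by rewrite /diffquot divfK// subr_eq0.
- apply/cvgrPdist_lt => e e0; rewrite eqxx.
  have /cvgrPdist_lt/(_ e e0) := C1plus_diffquot (ltW t0).
  rewrite near_withinE near_withinE => H.
  near=> u; have [_|ut] := eqVneq u t; first by rewrite subrr normr0.
  move: ut; have : `[0, +oo[%classic u.
    rewrite /= in_itv/= andbT; apply/ltW; near: u; exact: lt_nbhsr.
  move=> u0 ut; move: ut u0; near: u; exact: H.
- by rewrite eqxx.
Unshelve. all: end_near. Qed.

Lemma C1plus_MVT (a b : R) : 0 <= a -> a < b ->
  exists2 c, c \in `]a, b[ & f b - f a = nnderiv f c * (b - a).
Proof.
move=> a0 ab; apply: MVT => //.
  move=> x; rewrite in_itv/= => /andP[ax _]; apply: C1plus_is_derive.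
  exact: le_lt_trans ax.
apply: continuous_subspaceW C1plus_continuous => x /=.
by rewrite !in_itv/= andbT => /andP[ax _]; exact: le_trans ax.
Qed.

Lemma C1plus_lt (a b : R) : 0 <= a -> a < b -> f a < f b.
Proof.
move=> a0 ab; have [c] := C1plus_MVT a0 ab.
rewrite in_itv/= => /andP[ac _]; rewrite -subr_gt0 => ->.
rewrite mulr_gt0 ?subr_gt0//; have [_ _ _] := fC; apply.
exact: le_trans (ltW ac).
Qed.

Lemma C1plus_lipschitz (D a b : R) : 0 <= a -> 0 <= b -> a <= D -> b <= D ->
  `|f a - f b| <= maxnorm `[0, D] (nnderiv f) * `|a - b|.
Proof.
wlog ab : a b / a < b.
  move=> H a0 b0 aD bD; have [ab|ba|->] := ltgtP a b; first exact: H.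
    by rewrite distrC (distrC a); exact: H.
  by rewrite !subrr !normr0 mulr0.
move=> a0 b0 aD bD; have [c] := C1plus_MVT a0 ab.
rewrite in_itv/= => /andP[ac cb] fab.
rewrite distrC fab normrM (distrC b) ler_wpM2r//.
apply: le_maxnorm; first exact: segment_compact.
  have [_ _ + _] := fC; apply: continuous_subspaceW => x /=.
  by rewrite !in_itv/= andbT => /andP[].
by rewrite /= in_itv/= (le_trans a0 (ltW ac)) (le_trans (ltW cb)).
Qed.

Lemma nninvK (t : R) : 0 <= t -> nninv f (f t) = t.
Proof.
have [[_ inj_f _] _ _ _] := fC.
by move=> t0; apply: pinvKV => //; rewrite inE/= in_itv/= t0.
Qed.

Lemma nninvVK (u : R) : 0 <= u -> f (nninv f u) = u.
Proof.
have [[_ _ surj_f] _ _ _] := fC.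
by move=> u0; apply: (surjpK _ surj_f); rewrite inE/= in_itv/= u0.
Qed.

Lemma nninv_ge0 (u : R) : 0 <= u -> 0 <= nninv f u.
Proof.
have [bij_f _ _ _] := fC; have [fun_g _ _] := bijpinv_bij (fun=> 0) bij_f.
by move=> u0; have := fun_g u; rewrite /= !in_itv/= !andbT; apply.
Qed.

Lemma nninv_lt (a b : R) : 0 <= a -> 0 <= b -> (nninv f a < nninv f b) = (a < b).
Proof.
move=> a0 b0.
have [|] := ltP (nninv f a) (nninv f b).
  by move/(C1plus_lt (nninv_ge0 a0)); rewrite !nninvVK.
rewrite le_eqVlt => /predU1P[/(congr1 f)|/(C1plus_lt (nninv_ge0 b0))].
  by rewrite !nninvVK// => ->; rewrite ltxx.
by rewrite !nninvVK// => /ltW; rewrite ltNge => ->.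
Qed.

(** The inverse of an increasing bijection is continuous: the values of [nninv f]
    stay within [e] of [t] as long as the argument stays between [f (t - e)] and
    [f (t + e)].  If [t < e] the lower bound holds for free, as the values are
    nonnegative. *)
Lemma nninv_cvg (u : R) : 0 <= u ->
  nninv f v @[v --> within `[0, +oo[ (nbhs u)] --> nninv f u.
Proof.
move=> u0; apply/cvgrPdist_lt => e e0.
have t0 := nninv_ge0 u0; set t := nninv f u in t0 *.
have utpe : u < f (t + e).
  by rewrite -{1}(nninvVK u0); apply: C1plus_lt => //; rewrite ltrDl.
have near_tme : \forall v \near u, e <= t -> f (t - e) < v.
  have [et|te] := leP e t; last by apply: filterE.
  have tmeu : f (t - e) < u.
    by rewrite -{1}(nninvVK u0); apply: C1plus_lt; rewrite ?subr_ge0// gtrBl.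
  by apply: filterS (lt_nbhsr tmeu).
have tpe0 : 0 <= t + e by rewrite addr_ge0// ltW.
rewrite near_withinE; near=> v; rewrite /= in_itv/= andbT => v0.
rewrite ltr_norml ltrBlDr ltrBrDr; apply/andP; split.
  rewrite addrC ltrBlDr -(nninvK tpe0) nninv_lt ?C1plus_ge0//.
  by near: v; exact: lt_nbhsl.
have [te|te] := ltP t e; first by rewrite (lt_le_trans te)// lerDl nninv_ge0.
have tme0 : 0 <= t - e by rewrite subr_ge0.
rewrite -ltrBlDl -(nninvK tme0) nninv_lt ?C1plus_ge0//.
by move: te; near: v; exact: near_tme.
Unshelve. all: end_near. Qed.

(** Injectivity keeps the inverse away from its limit, so that limits of
    difference quotients, taken along punctured neighbourhoods, can be
    composed with it. *)
Lemma nninv_punctured (u : R) : 0 <= u ->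
  nninv f v @[v --> within `[0, +oo[ u^'] -->
  within `[0, +oo[ (nninv f u)^'.
Proof.
move=> u0 P PP.
have /(_ _ PP) := nninv_cvg u0.
rewrite !near_simpl !near_withinE; apply: filterS => v PPv vu v0.
have v0' : 0 <= v by move: v0; rewrite /= in_itv/= andbT.
apply: PPv => //; last by rewrite /= in_itv/= nninv_ge0.
by apply: contra vu => /eqP/(congr1 f); rewrite !nninvVK// => ->.
Qed.

(** Substituting [v = f w] inverts a difference quotient of [nninv f] into one of
    [f]; the argument is the same at [0] as elsewhere. *)
Lemma nninv_diffquot (u : R) : 0 <= u ->
  diffquot (nninv f) u v @[v --> within `[0, +oo[ u^'] -->
  (nnderiv f (nninv f u))^-1.
Proof.
move=> u0; have g0 := nninv_ge0 u0.
have f'gt0 : 0 < nnderiv f (nninv f u) by have [_ _ _] := fC; apply.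
have /cvg_trans : diffquot (nninv f) u v @[v --> within `[0, +oo[ u^'] `=>`
    (diffquot f (nninv f u) (nninv f v))^-1 @[v --> within `[0, +oo[ u^'].
  apply: near_eq_cvg; rewrite !near_withinE; apply: filterE => v _ /=.
  by rewrite in_itv/= andbT => v0; rewrite /diffquot invf_div !nninvVK.
apply; apply: cvgV; first by rewrite gt_eqF.
exact: cvg_comp (nninv_punctured u0) (C1plus_diffquot g0).
Qed.

Lemma nnderiv_nninv (u : R) : 0 <= u ->
  nnderiv (nninv f) u = (nnderiv f (nninv f u))^-1.
Proof.
move=> u0; have pF := nndnbhs_proper u0.
exact: cvg_lim (nninv_diffquot u0).
Qed.

(** This makes the mean value estimate [C1plus_lipschitz] and the boundedness of
    derivatives on segments available for inverse radius functions. *)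
Lemma C1plus_nninv : C1plus (nninv f).
Proof.
have [bij_f _ f'c f'gt0] := fC; split.
- exact: bijpinv_bij.
- by move=> u u0; apply: cvgP (nninv_diffquot u0).
- apply/subspace_continuousP => u /=; rewrite in_itv/= andbT => u0.
  have g0 := nninv_ge0 u0.
  rewrite /from_subspace nnderiv_nninv//.
  have /cvg_trans : nnderiv (nninv f) v @[v --> within `[0, +oo[ (nbhs u)] `=>`
      (nnderiv f (nninv f v))^-1 @[v --> within `[0, +oo[ (nbhs u)].
    apply: near_eq_cvg; rewrite !near_withinE; apply: filterE => v /=.
    by rewrite in_itv/= andbT => v0; rewrite nnderiv_nninv.
  apply; apply: cvgV; first by rewrite gt_eqF// f'gt0.
  have nninv_within : nninv f v @[v --> within `[0, +oo[ (nbhs u)] -->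
      within `[0, +oo[ (nbhs (nninv f u)).
    move=> P PP; have /(_ _ PP) := nninv_cvg u0.
    rewrite !near_simpl !near_withinE; apply: filterS => v Pv v0; apply: Pv => //.
    by move: v0; rewrite /= !in_itv/= !andbT => /nninv_ge0.
  apply: cvg_comp nninv_within _.
  by move/subspace_continuousP : f'c; apply; rewrite /= in_itv/= andbT.
- by move=> u u0; rewrite nnderiv_nninv// invr_gt0 f'gt0// nninv_ge0.
Qed.

End C1plusTheory.

(** * The Euclidean distance *)

(** Summing the squares of the components of [A *: b - C *: a], where [A] is the
    squared length of [a], [B] that of [b] and [C] the inner product, gives
    [A * (A * B - C ^+ 2)], which is therefore nonnegative. *)
Lemma cauchy_schwarz_sum (R : realDomainType) (I : finType) (a b : I -> R) :
  (\sum_i a i * b i) ^+ 2 <= (\sum_i a i ^+ 2) * (\sum_i b i ^+ 2).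
Proof.
set A := \sum_i a i ^+ 2; set B := \sum_i b i ^+ 2; set C := \sum_i a i * b i.
have A0 : 0 <= A by apply: sumr_ge0 => i _; exact: sqr_ge0.
have [A_eq0|A_neq0] := eqVneq A 0.
  suff -> : C = 0 by rewrite A_eq0 mul0r expr0n.
  apply: big1 => i _; suff -> : a i = 0 by rewrite mul0r.
  apply/eqP; rewrite -sqrf_eq0; apply/eqP.
  by apply: (psumr_eq0P _ A_eq0) => // j _; exact: sqr_ge0.
have Agt0 : 0 < A by rewrite lt_def A_neq0.
have : 0 <= \sum_i (A * b i - C * a i) ^+ 2.
  by apply: sumr_ge0 => i _; exact: sqr_ge0.
have -> : \sum_i (A * b i - C * a i) ^+ 2 = A * (A * B - C ^+ 2).
  under eq_bigr => i _.
    have -> : (A * b i - C * a i) ^+ 2 =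
        A ^+ 2 * b i ^+ 2 - 2 * A * C * (a i * b i) + C ^+ 2 * a i ^+ 2 by ring.
    over.
  rewrite big_split sumrB -!mulr_sumr /= -/A -/B -/C; ring.
by rewrite pmulr_rge0// subr_ge0.
Qed.

Lemma edist_ge0 (R : realType) (d : nat) (x y : 'rV[R]_d) : 0 <= edist x y.
Proof. exact: sqrtr_ge0. Qed.

Lemma edistC (R : realType) (d : nat) (x y : 'rV[R]_d) : edist x y = edist y x.
Proof. by congr Num.sqrt; apply: eq_bigr => i _; rewrite -sqrrN opprB. Qed.

Lemma edist_triangle (R : realType) (d : nat) (x y z : 'rV[R]_d) :
  edist x z <= edist x y + edist y z.
Proof.
rewrite -(ler_pXn2r (n := 2))// ?nnegrE ?addr_ge0 ?edist_ge0//.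
have sum_ge0 (v w : 'rV[R]_d) : 0 <= \sum_i (v 0 i - w 0 i) ^+ 2.
  by apply: sumr_ge0 => i _; exact: sqr_ge0.
rewrite sqrrD !sqr_sqrtr//.
pose S := \sum_i (x 0 i - y 0 i) * (y 0 i - z 0 i).
have -> : \sum_i (x 0 i - z 0 i) ^+ 2 =
    \sum_i (x 0 i - y 0 i) ^+ 2 + S *+ 2 + \sum_i (y 0 i - z 0 i) ^+ 2.
  by rewrite /S -sumrMnl -!big_split; apply: eq_bigr => i _ /=; ring.
rewrite lerD2r lerD2l lerMn2r/=.
rewrite -sqrtrM// (le_trans (ler_norm S))// -sqrtr_sqr ler_wsqrtr//.
exact: cauchy_schwarz_sum.
Qed.

(** The diameter is a supremum, hence an upper bound once the distances are
    bounded: [compact_bounded] bounds the sup norm on [K], hence every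
    coordinate, hence the Euclidean distances. *)
Lemma edist_le_diam (R : realType) (d : nat) (K : set 'rV[R]_d)
    (x y : 'rV[R]_d) : compact K -> K x -> K y -> edist x y <= diam K.
Proof.
move=> cK Kx Ky; apply: ub_le_sup; last by exists (x, y).
have [M [_ /(_ (M + 1))/(_ _)/= KM]] := compact_bounded cK.
have KM1 v : K v -> forall i, `|v 0 i| <= M + 1.
  move=> Kv i; apply: (le_trans _ (KM _ v Kv)); last by rewrite ltrDl.
  rewrite /Num.norm/= mx_normrE; exact: (le_bigmax _ _ (0, i)).
exists (Num.sqrt (\sum_(i < d) (2 * (M + 1)) ^+ 2)) => _ [[v w] [/= Kv Kw] <-].
apply: ler_wsqrtr; apply: ler_sum => i _.
have := KM1 v Kv i; have := KM1 w Kw i; rewrite !ler_norml => *; nra.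
Qed.

(** * Comparison of entry times *)

Lemma entry_le (R : realType) (d : nat) (X Y : set 'rV[R]_d)
    (r s : 'rV[R]_d -> R -> R) (p : 'rV[R]_d) (c : R) :
  radius_function X r -> Y !=set0 ->
  (forall y, Y y -> exists2 x, X x &
    nninv (r x) (edist p x) <= nninv (s y) (edist p y) + c) ->
  entry X r p <= entry Y s p + c.
Proof.
move=> rX [y0 Yy0] H; rewrite -lerBlDr; apply: lb_le_inf.
  by exists (nninv (s y0) (edist p y0)); exists y0.
move=> _ [y Yy <-]; have [x Xx xy] := H y Yy.
rewrite lerBlDr; apply: le_trans xy; apply: ge_inf; last by exists x.
exists 0 => _ [x' Xx' <-]; apply: (nninv_ge0 (rX _ Xx')); exact: edist_ge0.
Qed.

(** Pass through [g a]: first change the function, then move the argument. *)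
Lemma C1plus_dist_le (R : realType) (f g : R -> R) (D a b : R) :
  C1plus f -> C1plus g -> 0 <= a -> 0 <= b -> a <= D -> b <= D ->
  `|f a - g b| <=
    maxnorm `[0, D] (fun t => f t - g t) + `|a - b| * maxnorm `[0, D] (nnderiv g).
Proof.
move=> fC gC a0 b0 aD bD.
have -> : f a - g b = (f a - g a) + (g a - g b) by rewrite addrA subrK.
apply: le_trans (ler_normD _ _) _; apply: lerD; last first.
  by rewrite mulrC; exact: C1plus_lipschitz.
have sub : `[0, D] `<=` `[0, +oo[%classic.
  by move=> t /=; rewrite !in_itv/= andbT => /andP[].
apply: (@le_maxnorm _ _ _ (fun t => f t - g t)).
- exact: segment_compact.
- by apply: within_continuousB; apply: (continuous_subspaceW sub);
    exact: C1plus_continuous.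
- by rewrite /= in_itv/= a0.
Qed.

(** The absolute value lets one estimate serve both inequalities between the
    entry functions. *)
Lemma matched_times_le (R : realType) (d : nat) (X Y : set 'rV[R]_d)
    (r s : 'rV[R]_d -> R -> R) (eta : set ('rV[R]_d * 'rV[R]_d))
    (K : set 'rV[R]_d) (p x y : 'rV[R]_d) :
  finite_set X -> finite_set Y -> radius_function X r -> radius_function Y s ->
  eta `<=` X `*` Y -> compact K -> X `|` Y `<=` K -> K p -> eta (x, y) ->
  `|nninv (r x) (edist p x) - nninv (s y) (edist p y)| <=
    radius_dist r s eta K + relnorm eta * max_slope Y s K.
Proof.
move=> finX finY rX sY etaXY cK XYK Kp etaxy.
have finE : finite_set eta by exact: sub_finite_set etaXY (finite_setX finX finY).
have [/= Xx Yy] := etaXY _ etaxy.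
have Kx : K x by apply: XYK; left.
have Ky : K y by apply: XYK; right.
have gC := C1plus_nninv (sY _ Yy).
apply: le_trans (C1plus_dist_le (C1plus_nninv (rX _ Xx)) gC (edist_ge0 _ _)
  (edist_ge0 _ _) (edist_le_diam cK Kp Kx) (edist_le_diam cK Kp Ky)) _.
apply: lerD.
  exact: (finite_le_sup (fun q => maxnorm `[0, diam K]
    (fun t => nninv (r q.1) t - nninv (s q.2) t)) finE etaxy).
apply: ler_pM => //.
(* A supremum may be negative as such; this one bounds an absolute value. *)
- apply: le_trans (le_maxnorm (x := 0) _ _ _) => //.
  + exact: segment_compact.
  + have [_ _ + _] := gC; apply: continuous_subspaceW => t /=.
    by rewrite !in_itv/= andbT => /andP[].
  + by rewrite /= in_itv/= lexx (le_trans _ (edist_le_diam cK Kp Kp))// edist_ge0.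
- apply: (@le_trans _ _ (edist x y)); last first.
    exact: (finite_le_sup (fun q => edist q.1 q.2) finE etaxy).
  have := edist_triangle p x y; have := edist_triangle p y x.
  by rewrite (edistC y x) ler_norml; lra.
- exact: (finite_le_sup (fun z => maxnorm `[0, diam K] (nnderiv (nninv (s z))))
    finY Yy).
Qed.

Theorem theorem4p1 (R : realType) (d : nat) (X Y : set 'rV[R]_d)
    (r s : 'rV[R]_d -> R -> R) (eta : set ('rV[R]_d * 'rV[R]_d))
    (K : set 'rV[R]_d)
    (finX : finite_set X) (X0 : X !=set0)
    (finY : finite_set Y) (Y0 : Y !=set0)
    (rX : radius_function X r) (sY : radius_function Y s)
    (etaXY : correspondence X Y eta)
    (cK : compact K) (XYK : X `|` Y `<=` K) :
  maxnorm K (fun p => entry X r p - entry Y s p) <=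
  radius_dist r s eta K
  + relnorm eta * Num.max (max_slope X r K) (max_slope Y s K).
Proof.
have [eta_sub etaX etaY] := etaXY.
have [x0 Xx0] := X0.
have finE : finite_set eta by exact: sub_finite_set eta_sub (finite_setX finX finY).
have match_le p x y (Kp : K p) (xy : eta (x, y)) :=
  matched_times_le finX finY rX sY eta_sub cK XYK Kp xy.
set C := radius_dist r s eta K + _.
have leC : radius_dist r s eta K + relnorm eta * max_slope Y s K <= C.
  (* [relnorm eta] is nonnegative because [eta] is nonempty. *)
  rewrite lerD2l ler_wpM2l ?le_max ?lexx ?orbT//.
  have [y _ xy] := etaX _ Xx0; apply: le_trans (edist_ge0 x0 y) _.
  exact: (finite_le_sup (fun q => edist q.1 q.2) finE xy).
apply: ge_sup.
  by exists `|entry X r x0 - entry Y s x0|; exists x0 => //; apply: XYK; left.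
move=> _ [p Kp <-].
rewrite ler_norml lerBlDl lerBrDl; apply/andP; split.
- rewrite lerBlDr; apply: entry_le => // x Xx; have [y Yy xy] := etaX _ Xx.
  exists y => //.
  by have := le_trans (match_le p x y Kp xy) leC; rewrite ler_norml; lra.
- apply: entry_le => // y Yy; have [x Xx xy] := etaY _ Yy.
  exists x => //.
  by have := le_trans (match_le p x y Kp xy) leC; rewrite ler_norml; lra.
Qed.
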